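(* Let $\ell$ and $p$ be positive integers. Then the $p$th central moment $\mu_{p,f}^\ell\,\mathrm{ADF}(f)$ of the autocorrelation demerit factor over uniformly random binary sequences of length $\ell$ is nonnegative. Moreover, if (i) $p=1$, or (ii) $p$ is odd with $p>1$ and $\ell\le 3$, or (iii) $p$ is even and $\ell\le 2$, then $\mu_{p,f}^\ell\,\mathrm{ADF}(f)=0$; otherwise $\mu_{p,f}^\ell\,\mathrm{ADF}(f)>0$.
   Context: A sequence is a doubly infinite list $f=(\ldots,f_{-1},f_0,f_1,\ldots)$ of complex numbers with only finitely many nonzero terms. A binary sequence of length $\ell$ is a sequence with $f_j\in\{-1,1\}$ for $0\le j\le \ell-1$ and $f_j=0$ for all other $j\in\mathbb{Z}$; $\mathrm{Seq}(\ell)$ is the set of all $2^\ell$ of them with the uniform probability measure. The aperiodic autocorrelation of $f$ at shift $s\in\mathbb{Z}$ is $C_f(s)=\sum_{j\in\mathbb{Z}} f_{j+s}\overline{f_j}$. The autocorrelation demerit factor of a nonzero sequence $f$ is $\mathrm{ADF}(f)=\frac{\sum_{s\in\mathbb{Z}, s\neq 0}|C_f(s)|^2}{C_f(0)^2}$. For a random variable $v(f)$ with $f$ uniform in $\mathrm{Seq}(\ell)$, $\mathbb{E}_f^\ell v(f)$ is its expected value and the $p$th central moment is $\mu_{p,f}^\ell v(f)=\mathbb{E}_f^\ell\big(v(f)-\mathbb{E}_f^\ell v(f)\big)^p$. *)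

(* Defs.v *)
From HB Require Import structures.
From mathcomp Require Import all_boot all_order all_algebra.
From mathcomp Require Import finmap.
From mathcomp Require Import all_classical all_reals.
From mathcomp Require Import complex.
Set Implicit Arguments.
Unset Strict Implicit.
Unset Printing Implicit Defensive.
Import Order.TTheory GRing.Theory Num.Theory.
Local Open Scope classical_set_scope.
Local Open Scope complex_scope.
Local Open Scope ring_scope.

Definition sequence (R : realType) := {fsfun int -> R[i] with 0}.

Definition is_binary (R : realType) (l : nat) (f : sequence R) : Prop :=
  forall j : int, if 0 <= j < l%:Z then f j = -1 \/ f j = 1 else f j = 0.

Definition Seq (R : realType) (l : nat) : set (sequence R) :=
  [set f | is_binary l f].

(* Here and in [ADF] the sum over the infinite index set is [fsbig], i.e. the
   sum over the support of the summand; as [f] has finite support, so does the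
   summand. *)
Definition autocorr (R : realType) (f : sequence R) (s : int) : R[i] :=
  \sum_(j \in [set: int]) f (j + s) * (f j)^*%C.

(* Values of [ADF], and the expectations below, are kept in [R[i]]; there
   [0 <= z] and [0 < z] include the assertion that [z] is real.
   At [f = 0], where the demerit factor is undefined, [ADF f] is [0]. *)
Definition ADF (R : realType) (f : sequence R) : R[i] :=
  (\sum_(s \in [set s : int | s != 0]) `|autocorr f s| ^+ 2)
  / autocorr f 0 ^+ 2.

Definition expectation (R : realType) (l : nat) (v : sequence R -> R[i])
    : R[i] :=
  (\sum_(f \in @Seq R l) v f) / #|` fset_set (@Seq R l)|%:R.

Definition central_moment (R : realType) (p l : nat)
    (v : sequence R -> R[i]) : R[i] :=
  expectation l (fun f => (v f - expectation l v) ^+ p).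

(* Main.v *)
(** Expanding the squares, [l ^ 2 * ADF f] is the sum of the monomials
    [f_a f_b f_c f_d] over all quadruples with [a - b = c - d] and [a <> b].
    A monomial in signs has mean 0 unless each of its letters occurs an even
    number of times, in which case it is constantly 1.  Centering therefore just
    removes the even monomials, and the [p]th central moment is, up to the
    factor [l ^ (- 2 p)], the number of [p]-tuples of non-even monomials whose
    product is even.  Hence it is nonnegative, and it is positive as soon as one
    such tuple exists: repeat one monomial if [p] is even, and complete the
    relation [f_0f_2 * f_1f_3 * f_0f_1f_2f_3 = 1] in this way if [p] is odd and
    [l >= 4].  For [l <= 3] every non-even monomial contains the letter 0 an odd
    number of times, so no product of an odd number of them is even. *)
Require Import Defs.
From mathcomp Require Import all_boot all_order all_algebra.
From mathcomp Require Import finmap.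
From mathcomp Require Import all_classical all_reals.
From mathcomp Require Import complex.
From mathcomp Require Import zify.
Set Implicit Arguments.
Unset Strict Implicit.
Unset Printing Implicit Defensive.
Import Order.TTheory GRing.Theory Num.Theory.
Local Open Scope ring_scope.

(** * Words and the parities of their letters *)

(* The word [w] stands for the monomial [\prod_(i <- w) f_i]. *)
Definition even_word {n : nat} (w : seq 'I_n) : bool :=
  [forall i, ~~ odd (count_mem i w)].

(** Kept as a list with repetitions, so that counting its even entries counts tuples of words. *)
Definition word_products {n : nat} (L : seq (seq 'I_n)) (p : nat) :
    seq (seq 'I_n) :=
  iter p (fun M => [seq u ++ v | u <- L, v <- M]) [:: [::]].

Lemma even_nil n : even_word ([::] : seq 'I_n).
Proof. exact/forallP. Qed.

Lemma even_cat_self n (u w : seq 'I_n) :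
  even_word (u ++ u ++ w) = even_word w.
Proof.
by apply: eq_forallb => i; rewrite !count_cat addnA oddD addnn odd_double.
Qed.

Lemma mem_word_products1 n (L : seq (seq 'I_n)) p u w :
  u \in L -> w \in word_products L p -> u ++ w \in word_products L p.+1.
Proof. by move=> uL wL; apply/allpairsP; exists (u, w). Qed.

(** Prepending [u] twice changes no parity, so an even product can be lengthened by any even number
    of factors. *)
Lemma even_word_products n (L : seq (seq 'I_n)) p u w k :
  u \in L -> w \in word_products L p -> even_word w ->
  has even_word (word_products L (k.*2 + p)).
Proof.
move=> uL wL we.
suff [v vL ve] : exists2 v, v \in word_products L (k.*2 + p) & even_word v.
  by apply/hasP; exists v.
elim: k => [|k [v vL ve]]; first by exists w.
exists (u ++ u ++ v); last by rewrite even_cat_self.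
by rewrite doubleS !addSn; do 2!(apply: mem_word_products1 => //).
Qed.

(** Parities of counts add under concatenation; for odd [p] this rules out even products. *)
Lemma odd_count_word_products n (L : seq (seq 'I_n)) p i :
  {in L, forall w, odd (count_mem i w)} ->
  {in word_products L p, forall w, odd (count_mem i w) = odd p}.
Proof.
move=> oddL; elim: p => [|p IHp] w; first by rewrite inE => /eqP->.
by case/allpairsP=> -[u v] /= [uL vL ->]; rewrite count_cat oddD oddL ?IHp.
Qed.

(** * Monomials in signs and their averages *)

Section Monomials.
Variables (T : numDomainType) (n : nat).
Implicit Types (x : {ffun 'I_n -> bool}) (w : seq 'I_n) (L : seq (seq 'I_n)).

Definition monomial w x : T := \prod_(i <- w) (-1) ^+ x i.

Definition word_sum L x : T := \sum_(w <- L) monomial w x.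

Lemma monomial_cat u w x : monomial (u ++ w) x = monomial u x * monomial w x.
Proof. exact: big_cat. Qed.

Lemma word_sum_products L p x : word_sum (word_products L p) x = word_sum L x ^+ p.
Proof.
elim: p => [|p IHp]; first by rewrite /word_sum big_seq1 /monomial big_nil.
rewrite exprS -IHp /word_sum /= big_allpairs_dep mulr_suml.
apply: eq_bigr => u _; rewrite mulr_sumr; apply: eq_bigr => v _.
exact: monomial_cat.
Qed.

Lemma monomial_count w x :
  monomial w x = \prod_i ((-1) ^+ x i) ^+ count_mem i w.
Proof.
rewrite /monomial; elim: w => [|j w IHw].
  by rewrite big_nil big1 // => i _; rewrite expr0.
rewrite big_cons IHw (bigD1 j) //= [RHS](bigD1 j) //= eqxx add1n exprS mulrA.
by congr (_ * _); apply: eq_bigr => i /negPf; rewrite eq_sym => ->.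
Qed.

Lemma monomial_even w x : even_word w -> monomial w x = 1.
Proof.
move/forallP=> we; rewrite monomial_count big1 // => i _.
by rewrite -exprM -signr_odd oddM (negPf (we i)) andbF.
Qed.

Definition flip i x : {ffun 'I_n -> bool} := [ffun k => x k (+) (k == i)].

Lemma flipK i : involutive (flip i).
Proof. by move=> x; apply/ffunP => k; rewrite !ffunE -addbA addbb addbF. Qed.

Lemma monomial_flip i w x :
  monomial w (flip i x) = (-1) ^+ count_mem i w * monomial w x.
Proof.
rewrite /monomial; elim: w => [|j w IHw]; first by rewrite !big_nil mulr1.
rewrite !big_cons IHw ffunE signr_addb /= exprD.
by rewrite (mulrC ((-1) ^+ x j)) mulrACA.
Qed.

Lemma sum_monomial w :
  \sum_x monomial w x = #|{: {ffun 'I_n -> bool}}|%:R * (even_word w)%:R.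
Proof.
case: (boolP (even_word w)) => [we|/forallPn[i /negPn wi]].
  by rewrite (eq_bigr (fun=> 1)) ?sumr_const ?mulr1 // => x _; apply: monomial_even.
(* Flipping the sign at a letter [i] of odd count negates the monomial, so the sum is its own
   negative. *)
rewrite mulr0; apply/eqP; rewrite -[_ == 0](mulrn_eq0 _ 2) mulr2n addr_eq0.
rewrite {1}(reindex_inj (inv_inj (flipK i))) -sumrN; apply/eqP/eq_bigr => x _.
by rewrite monomial_flip -signr_odd wi expr1 mulN1r.
Qed.

Lemma sum_word_sum L :
  \sum_x word_sum L x =
  #|{: {ffun 'I_n -> bool}}|%:R * (count even_word L)%:R.
Proof.
rewrite exchange_big /= (eq_bigr _ (fun w _ => sum_monomial w)) -mulr_sumr.
congr (_ * _); elim: L => [|w L IHL]; first by rewrite big_nil.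
by rewrite big_cons IHL /= natrD.
Qed.

Lemma word_sum_center L x :
  word_sum L x - (count even_word L)%:R =
  word_sum [seq w <- L | ~~ even_word w] x.
Proof.
rewrite /word_sum; elim: L => [|w L IHL]; first by rewrite !big_nil subr0.
rewrite big_cons /=; case: ifPn => [we|/negPn we].
  by rewrite big_cons -IHL (negPf we) add0n addrA.
by rewrite -IHL we monomial_even // natrD opprD addrACA subrr add0r.
Qed.

End Monomials.

Arguments word_sum T {n} L x.

(** * Autocorrelations of binary sequences as sums over words *)

(** Pairs [(a, b)], [(c, d)] with the same nonzero shift [a - b = c - d], written additively because
    subtraction in [nat] truncates. *)
Definition quadruples l : seq ('I_l * 'I_l * ('I_l * 'I_l)) :=
  [seq q : 'I_l * 'I_l * ('I_l * 'I_l) <- enum predT |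
   (q.1.1 != q.1.2) && (q.1.1 + q.2.2 == q.2.1 + q.1.2)%N].

Definition demerit_words l : seq (seq 'I_l) :=
  [seq [:: q.1.1; q.1.2; q.2.1; q.2.2] | q <- quadruples l].

Section Binary.
Variables (R : realType) (l : nat).
Implicit Types (x : {ffun 'I_l -> bool}).
Local Notation C := R[i]%C.

Definition sign_value x (j : int) : C :=
  if j is Posz m then oapp (fun i => (-1) ^+ x i) 0 (insub m) else 0.

Definition binary_of x : sequence R :=
  [fsfun j in [fset (Posz (val i)) | i in 'I_l]%fset => sign_value x j].

Lemma sign_value_ord x (i : 'I_l) : sign_value x i%:Z = (-1) ^+ x i.
Proof. by rewrite /sign_value valK. Qed.

Lemma binary_ofE x j : binary_of x j = sign_value x j.
Proof.
rewrite fsfunE; case: ifPn => // /imfsetP jP.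
case: j jP => // m jP; rewrite /sign_value; case: insubP => //= i _ im.
by case: jP; exists i; rewrite //= im.
Qed.

Lemma binary_of_is_binary x : is_binary l (binary_of x).
Proof.
move=> j; rewrite binary_ofE /sign_value; case: j => [m|m] //.
case: insubP => [i lm <-|lm]; rewrite ltz_nat /=.
  by rewrite ltn_ord; case: (x i); [left; rewrite expr1|right].
by rewrite (negPf lm).
Qed.

Lemma binary_of_inj : injective binary_of.
Proof.
move=> x y /(congr1 (fun f : sequence R => f _)) xy; apply/ffunP => i.
have := xy i%:Z; rewrite !binary_ofE !sign_value_ord.
exact: (@signr_inj C).
Qed.

Lemma binary_of_surj (f : sequence R) : is_binary l f -> exists x, f = binary_of x.
Proof.
move=> fb; exists [ffun i : 'I_l => f (Posz (val i)) == -1]; apply/fsfunP => j.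
rewrite binary_ofE; have := fb j; rewrite /sign_value.
case: j => [m|m] //=; case: insubP => [i lm <-|lm]; rewrite ltz_nat /=.
  rewrite ltn_ord ffunE => -[] ->; first by rewrite eqxx expr1.
  by rewrite -addr_eq0 -mulr2n pnatr_eq0.
by rewrite (negPf lm).
Qed.

Lemma finite_Seq : finite_set (@Seq R l).
Proof.
apply: (@sub_finite_set _ _ [set binary_of x | x in setT]%classic).
  by move=> f /binary_of_surj[x ->]; exists x.
exact/finite_image/finite_finset.
Qed.

Lemma perm_Seq :
  perm_eq (fset_set (@Seq R l)) [seq binary_of x | x <- enum {: {ffun 'I_l -> bool}}].
Proof.
have fin := finite_Seq.
apply: uniq_perm => [||f]; first exact: fset_uniq.
  by rewrite (map_inj_uniq binary_of_inj) enum_uniq.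
rewrite in_fset_set //; apply/idP/mapP => [/set_mem /binary_of_surj[x ->]|[x _ ->]].
  by exists x; rewrite ?mem_enum.
exact/mem_set/binary_of_is_binary.
Qed.

Lemma expectationE (v : sequence R -> C) :
  expectation l v = (\sum_x v (binary_of x)) / #|{: {ffun 'I_l -> bool}}|%:R.
Proof.
have fin := finite_Seq.
rewrite /expectation fsbig_finite // (perm_big _ perm_Seq) big_map.
by rewrite (perm_size perm_Seq) size_map -cardE big_enum.
Qed.

Lemma binary_of_ord x (i : 'I_l) : binary_of x i%:Z = (-1) ^+ x i.
Proof. by rewrite binary_ofE sign_value_ord. Qed.

Lemma binary_of_supp x j :
  j \notin [seq i%:Z | i : 'I_l] -> binary_of x j = 0.
Proof.
rewrite binary_ofE /sign_value; case: j => [m|m] //; case: insubP => //= i _ <-.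
by rewrite map_f ?mem_enum.
Qed.

(** Turns the value at [j + s] into a sum over an index, so that an autocorrelation becomes a sum
    over pairs of indices. *)
Lemma binary_of_sum x j :
  binary_of x j = \sum_(i : 'I_l | i%:Z == j) (-1) ^+ x i.
Proof.
case: (boolP (j \in [seq i%:Z | i : 'I_l])) => [/mapP[i _ ->]|jl].
  by rewrite binary_of_ord (big_pred1 i) // => k; rewrite eqz_nat.
rewrite binary_of_supp // big_pred0 // => i; apply/eqP => ij.
by rewrite -ij map_f ?mem_enum in jl.
Qed.

Lemma autocorrE x s :
  autocorr (binary_of x) s =
  \sum_(q : 'I_l * 'I_l | q.1%:Z - q.2%:Z == s) (-1) ^+ x q.1 * (-1) ^+ x q.2.
Proof.
rewrite /autocorr (fsbigE [seq i%:Z | i : 'I_l]) //; first last.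
- by move=> j _ jl; rewrite (binary_of_supp x jl) rmorph0 mulr0.
- by rewrite map_inj_uniq ?enum_uniq // => i k [] /val_inj.
rewrite big_map big_enum_cond /= (eq_bigl xpredT); last first.
  by move=> i; rewrite in_setT.
rewrite -(pair_big_dep xpredT (fun a b : 'I_l => a%:Z - b%:Z == s)
  (fun a b => (-1) ^+ x a * (-1) ^+ x b)) /=.
rewrite [RHS](exchange_big_dep xpredT) //=.
apply: eq_bigr => b _; rewrite binary_of_ord rmorph_sign binary_of_sum mulr_suml.
by apply: eq_bigl => a; rewrite subr_eq addrC.
Qed.

Lemma autocorr_real x s : autocorr (binary_of x) s \is Num.real.
Proof. by rewrite autocorrE rpred_sum // => q _; rewrite rpredM ?rpred_sign. Qed.

Lemma autocorr0 x : autocorr (binary_of x) 0 = l%:R.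
Proof.
rewrite autocorrE -(pair_big_dep xpredT (fun a b : 'I_l => a%:Z - b%:Z == 0)
  (fun a b => (-1) ^+ x a * (-1) ^+ x b)) /=.
rewrite (eq_bigr (fun=> 1)) ?sumr_const ?card_ord // => a _.
rewrite (big_pred1 a) -?signr_addb ?addbb // => b /=.
by rewrite subr_eq0 eqz_nat eq_sym.
Qed.

Lemma sum_autocorr x :
  \sum_(s \in [set s : int | s != 0]%classic) `|autocorr (binary_of x) s| ^+ 2
  = word_sum C (demerit_words l) x.
Proof.
(* Every shift outside the finite list [r] of index differences has autocorrelation 0. *)
pose r : seq int := undup [seq q.1%:Z - q.2%:Z | q : 'I_l * 'I_l].
have rP (a b : 'I_l) : a%:Z - b%:Z \in r.
  by rewrite mem_undup; apply/mapP; exists (a, b); rewrite ?mem_enum.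
have -> : \sum_(s \in [set s : int | s != 0]%classic) `|autocorr (binary_of x) s| ^+ 2
   = \sum_(s <- r | s != 0) `|autocorr (binary_of x) s| ^+ 2.
  apply/esym/(@bigfs _ _ _ _ r (fun s : int => s != 0)); first exact: undup_uniq.
  move=> s _ sr; rewrite autocorrE big_pred0 ?normr0 ?expr0n // => -[a b] /=.
  by apply/eqP => ab; rewrite -ab rP in sr.
rewrite /word_sum /demerit_words big_map big_filter big_enum_cond /=.
(* Autocorrelations are real, so the squared modulus is a plain square: a double sum over pairs of
   difference [s]. *)
under eq_bigr => s _.
  rewrite real_normK ?autocorr_real // autocorrE expr2 big_distrlr pair_big /=.
  over.
rewrite (exchange_big_dep xpredT) //= [RHS]big_mkcond /=.
apply: eq_bigr => -[[a b] [c d]] _ /=.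
(* A fixed quadruple contributes only at the shift [s = a - b]. *)
rewrite big_mkcond (bigD1_seq (a%:Z - b%:Z)) ?rP ?undup_uniq //= big1 => [|s sab].
  rewrite addr0 eqxx subr_eq0 eqz_nat /= (inj_eq val_inj).
  have -> : (c%:Z - d%:Z == a%:Z - b%:Z) = (a + d == c + b)%N by lia.
  by rewrite /monomial !big_cons big_nil mulr1 -!mulrA.
by rewrite [_ == s]eq_sym (negPf sab) andbF.
Qed.

Lemma ADFE x :
  ADF (binary_of x) = word_sum C (demerit_words l) x / l%:R ^+ 2.
Proof. by rewrite /ADF sum_autocorr autocorr0. Qed.

Lemma central_moment_ADF p :
  central_moment p l (@ADF R) =
  (count even_word
    (word_products [seq w <- demerit_words l | ~~ even_word w] p))%:R
  / (l%:R ^+ 2) ^+ p.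
Proof.
have N0 : #|{: {ffun 'I_l -> bool}}|%:R != 0 :> C.
  by rewrite pnatr_eq0 -lt0n; apply/card_gt0P; exists [ffun=> true].
have mean : expectation l (@ADF R) =
    (count even_word (demerit_words l))%:R / l%:R ^+ 2.
  rewrite expectationE (eq_bigr _ (fun x _ => ADFE x)) -mulr_suml sum_word_sum.
  by rewrite mulrAC [_ * (count _ _)%:R]mulrC mulfK.
rewrite /central_moment mean expectationE.
under eq_bigr => x _.
  rewrite ADFE -mulrBl word_sum_center expr_div_n -word_sum_products.
  over.
by rewrite /= -mulr_suml sum_word_sum mulrAC [_ * (count _ _)%:R]mulrC mulfK.
Qed.

End Binary.

(** * Non-even demerit words and their even products *)

(** If [a = c] then [b = d] and the letters pair up; otherwise [a] or [b] occurs exactly once. *)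
Lemma even_quadruple l (a b c d : 'I_l) : a != b -> (a + d = c + b)%N ->
  even_word [:: a; b; c; d] = (a == c).
Proof.
move=> ab abcd; have [ac|ac] := eqVneq a c.
  have -> : d = b by apply: val_inj => /=; rewrite ac in abcd; lia.
  by rewrite -ac (even_cat_self [:: a; b] [::]) even_nil.
apply/negbTE/forallPn; move: ab ac; rewrite -!val_eqE /= => ab ac.
(* When [a = d] the letters [b, a, c] form an arithmetic progression, so [a]
   occurs twice but [b] only once. *)
have [ad|ad] := eqVneq (a : nat) d; [exists b | exists a];
  by rewrite /= -!val_eqE /=; lia.
Qed.

Lemma mem_noneven_demerit_words l (w : seq 'I_l) :
  reflect (exists a b c d : 'I_l,
             [/\ w = [:: a; b; c; d], a != b, a != c & (a + d = c + b)%N])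
          (w \in [seq w <- demerit_words l | ~~ even_word w]).
Proof.
rewrite mem_filter; apply: (iffP andP) => [[we /mapP[[[a b] [c d]]]]|].
  rewrite mem_filter /= => /andP[/andP[ab /eqP abcd] _] ew.
  by exists a, b, c, d; rewrite -(even_quadruple ab abcd) -ew.
case=> a [b] [c] [d] [-> ab ac abcd]; rewrite even_quadruple //; split=> //.
by apply/mapP; exists (a, b, (c, d)); rewrite // mem_filter /= ab abcd eqxx mem_enum.
Qed.

(** Two distinct pairs below 3 share a nonzero difference only if it is 1 or -1, so the letters are
    0, 1, 1, 2 up to order. *)
Lemma odd_demerit_words3 l (i : 'I_l) : (l <= 3)%N -> i = 0%N :> nat ->
  {in [seq w <- demerit_words l | ~~ even_word w],
    forall w, odd (count_mem i w)}.
Proof.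
move=> l3 i0 w /mem_noneven_demerit_words[a [b [c [d [-> ab ac abcd]]]]].
move: ab ac (ltn_ord a) (ltn_ord b) (ltn_ord c) (ltn_ord d).
by rewrite /= -!val_eqE /=; lia.
Qed.

(** Below 2, a nonzero difference determines its pair, forcing [a = c]. *)
Lemma demerit_words2 l : (l <= 2)%N ->
  [seq w <- demerit_words l | ~~ even_word w] = [::].
Proof.
move=> l2; case defL: [seq w <- _ | _] => [//|w s].
have /mem_noneven_demerit_words[a [b [c [d [_ ab ac abcd]]]]] :
  w \in [seq w <- demerit_words l | ~~ even_word w] by rewrite defL mem_head.
move: ab ac (ltn_ord a) (ltn_ord b) (ltn_ord c) (ltn_ord d).
by rewrite -!val_eqE /=; lia.
Qed.

Lemma even_demerit_words l p : p != 1%N ->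
  (if odd p then 3 < l else 2 < l)%N ->
  has even_word
    (word_products [seq w <- demerit_words l | ~~ even_word w] p).
Proof.
set L := [seq w <- _ | _] => p1 lp.
have l2 : (2 < l)%N by case: ifP lp => _ //; apply: ltnW.
pose o (i : 'I_3) : 'I_l := widen_ord l2 i.
(* From [1 - 0 = 2 - 1]; as a monomial this is [f_0 f_2]. *)
have u1L : [:: o 1; o 0; o 2; o 1] \in L.
  by apply/mem_noneven_demerit_words; exists (o 1), (o 0), (o 2), (o 1).
case: ifP lp => podd lp.
  pose s (i : 'I_4) : 'I_l := widen_ord lp i.
  (* An odd [p] other than 1 is at least 3: three factors form the relation, and the rest are copies
     of one word. *)
  have -> : p = ((p - 3)./2.*2 + 3)%N by lia.
  have u2L : [:: s 1; s 0; s 2; s 1] \in L.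
    by apply/mem_noneven_demerit_words; exists (s 1), (s 0), (s 2), (s 1).
  have u3L : [:: s 2; s 1; s 3; s 2] \in L.
    by apply/mem_noneven_demerit_words; exists (s 2), (s 1), (s 3), (s 2).
  have u4L : [:: s 1; s 0; s 3; s 2] \in L.
    by apply/mem_noneven_demerit_words; exists (s 1), (s 0), (s 3), (s 2).
  (* In this product the letters 0, 1, 2, 3 occur 2, 4, 4, 2 times. *)
  apply: (even_word_products _ u2L (w := [:: s 1; s 0; s 2; s 1]
    ++ [:: s 2; s 1; s 3; s 2] ++ [:: s 1; s 0; s 3; s 2] ++ [::])).
    by do 3!(apply: mem_word_products1 => //).
  by apply/forallP => i /=; lia.
(* For even [p], start from the empty product and add pairs of one word. *)
have -> : p = (p./2.*2 + 0)%N by lia.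
by apply: (even_word_products _ u1L (w := [::])); rewrite ?mem_head ?even_nil.
Qed.

Theorem theorem1p5 (R : realType) (l p : nat) (hl : (0 < l)%N) (hp : (0 < p)%N) :
  let mu := central_moment p l (@ADF R) in
  let vanishing := p = 1%N
                   \/ (odd p /\ (1 < p)%N /\ (l <= 3)%N)
                   \/ (~~ odd p /\ (l <= 2)%N) in
  0 <= mu /\ (vanishing -> mu = 0) /\ (~ vanishing -> 0 < mu).
Proof.
rewrite /= central_moment_ADF; set L := [seq w <- _ | _].
have lp : 0 < (l%:R ^+ 2) ^+ p :> R[i]%C by rewrite !exprn_gt0 // ltr0n.
split; first by rewrite divr_ge0 ?ler0n // ltW.
split=> [van|nvan].
  suff /negbTE : ~~ has even_word (word_products L p).
    by rewrite has_count lt0n => /negbFE/eqP->; rewrite mul0r.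
  case: van => [->|[[podd [_ l3]]|[_ l2]]].
  - apply/hasP => -[w /allpairsP[[u v] /= [uL]]]; rewrite inE => /eqP-> ->.
    by move: uL; rewrite cats0 mem_filter => /andP[/negbTE->].
  (* The letter 0 exists since [l > 0], and occurs an odd number of times in each product of [p]
     words. *)
  - apply/hasP => -[w wL /forallP /(_ (Ordinal hl))].
    have odd0 := @odd_demerit_words3 l (Ordinal hl) l3 erefl.
    by rewrite (odd_count_word_products odd0 wL) podd.
  (* Writing [p] as a successor exposes a factor taken from the empty list. *)
  - by rewrite /L demerit_words2 // -(prednK hp).
have p1 : p != 1%N by apply/eqP => p1; apply: nvan; left.
rewrite divr_gt0 // ltr0n -has_count even_demerit_words //.
(* A failure of the bound on [l] would be one of the vanishing cases. *)
case: ifP => podd; rewrite ltnNge; apply/negP => ll; apply: nvan; right.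
  by left; do 2!split=> //; lia.
by right; rewrite podd.
Qed.
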